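(* Let $G$ be a subgroup of the additive group $\mathbb{Q}$ of rational numbers. A nonempty set $X\subseteq G$ is midconvex (in $G$) if and only if $X = C\cap(H+x)$ for some order-convex set $C\subseteq\mathbb{Q}$, some $x\in X$ and some subgroup $H$ of $G$ such that the quotient group $G/H$ contains no elements of even order.
   Context: A subset $X$ of an Abelian group $G$ (written additively) is called midconvex if for every $x,y\in X$ the set $\frac{x+y}{2} := \{z\in G : 2z = x+y\}$ is a subset of $X$. A subset $C\subseteq\mathbb{Q}$ is order-convex (in $\mathbb{Q}$) if for every $a,b\in C$ the set $\{q\in\mathbb{Q} : a\le q\le b\}$ is a subset of $C$. The notation $H+x$ means $\{h+x : h\in H\}$. The order of an element $g$ of a group is the smallest positive integer $n$ such that $ng=0$; if $ng\neq 0$ for all positive integers $n$, then $g$ has infinite order (which counts as neither even nor odd). *)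

(* Defs.v *)
From HB Require Import structures.
From mathcomp Require Export all_boot all_order all_algebra.
From mathcomp Require Export boolp classical_sets num_normedtype.
Export Quotient.Exports.

Set Implicit Arguments.
Unset Strict Implicit.
Unset Printing Implicit Defensive.

Import GRing.Theory.

Local Open Scope classical_set_scope.
Local Open Scope ring_scope.

(* Subgroups are bundled boolean predicates ([zmodClosed V]); in the classical
   setting of [boolp] every subset of V is given by such a predicate, so these
   are all the subgroups, not only the decidable ones. *)

(* A subgroup of V as an abelian group in its own right. *)
Definition subgroup (V : zmodType) (G : zmodClosed V) : Type :=
  {x : V | x \in G}.

HB.instance Definition _ (V : zmodType) (G : zmodClosed V) :=
  SubChoice.on (subgroup G).
HB.instance Definition _ (V : zmodType) (G : zmodClosed V) :=
  [SubChoice_isSubZmodule of subgroup G by <:].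

Definition midpoints (V : zmodType) (x y : V) : set V :=
  [set z | z *+ 2 = x + y].

Definition midconvex (V : zmodType) (X : set V) : Prop :=
  forall x y, X x -> X y -> midpoints x y `<=` X.

Definition translate (V : zmodType) (A : set V) (x : V) : set V :=
  [set h + x | h in A].

Definition has_order (V : zmodType) (g : V) (n : nat) : Prop :=
  [/\ (0 < n)%N, g *+ n = 0 &
      forall m : nat, (0 < m)%N -> g *+ m = 0 -> (n <= m)%N].

Definition has_even_order (V : zmodType) (g : V) : Prop :=
  exists2 n, has_order g n & ~~ odd n.

(* Main.v *)
Require Import Defs.
From HB Require Import structures.
From mathcomp Require Import zify ring lra.
Import Order.TTheory GRing.Theory Num.Theory.

(** The implication from right to left is a computation: a midpoint of two
    points of X lies between them, hence in C, and twice its difference with x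
    lies in H, which can be halved in H because G / H has no 2-torsion
    ([no_even_order_quotP]).

    For the converse, C is the order-convex hull of X and H is the subgroup
    generated by the differences of elements of X.  Everything is reduced to
    subsets of the integers, because any finite set of elements of G, a group
    of rationals, lies in one cyclic subgroup ([common_divisor_seq]): after
    translation by a point x of X, the trace of X on this subgroup is a
    midconvex set P of integers containing 0.

    Such a P consists of the multiples of some d in an interval, with d = 0 or
    d odd ([midconvex_int_progression]).  Indeed, take a and a + d in P with
    d > 0 minimal; d is odd, since otherwise the midpoint would give a smaller
    gap.  Any q in P has the same parity as exactly one of a and a + d; the
    midpoint of q with that one is in P and closer to the pair, unless q is
    itself a or a + d, so that induction gives d | q - a.  Dividing by d one is left with a midconvex set of integers
    containing two consecutive integers, and a similar induction shows that it
    has no holes ([midconvex_int_interval]).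

    Each property required of H, namely closure under subtraction, stability
    under halving and X = C `&` (H + x), involves finitely many elements of G,
    so it is read off from the description of P in a cyclic subgroup
    containing them all ([midconvex_chart]). *)

Set Implicit Arguments.
Unset Strict Implicit.
Unset Printing Implicit Defensive.

Local Open Scope classical_set_scope.
Local Open Scope ring_scope.

(** * Midconvex sets of integers *)

Lemma midconvex_affine (U V : zmodType) (X : set V) (f : U -> V) (x : V) :
  {morph f : u v / u + v} -> midconvex X -> midconvex [set u | X (x + f u)].
Proof.
move=> fD mX u v Xu Xv w w2; apply: (mX _ _ Xu Xv).
by rewrite /midpoints /= mulrnDl [f w *+ 2]mulr2n -fD -mulr2n w2 fD addrACA.
Qed.

Lemma midconvex_int (P : set int) (m p q : int) :
  midconvex P -> P p -> P q -> m + m = p + q -> P m.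
Proof.
by move=> mP Pp Pq mpq; apply: (mP p q) => //; rewrite /midpoints /= mulr2n.
Qed.

(** By induction on q - c: the midpoint m of q and whichever of c, c + 1 has the
    parity of q is a smaller instance, which fills [c, m]; in particular
    m - 1 and m are in P, and from them a smaller instance fills [m - 1, q]. *)
Lemma midconvex_int_fill_right (P : set int) (c q n : int) :
  midconvex P -> P c -> P (c + 1) -> P q -> c <= n <= q -> P n.
Proof.
move=> mP; have [N leN] : exists N : nat, q - c <= N%:Z.
  by exists `|q - c|%N; lia.
elim: N c q n leN => [|N IH] c q n leN Pc Pc1 Pq cnq.
  by rewrite (_ : n = c) //; lia.
have [->//|nc] := eqVneq n c.
have [->//|nc1] := eqVneq n (c + 1).
have [->//|nq] := eqVneq n q.
have [m [Pm m2]] : exists m, P m /\ (m + m = q + c \/ m + m = q + (c + 1)).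
  have [m2|m2] : 2 * ((q - c) %/ 2)%Z = q - c \/
                 2 * ((q - c) %/ 2)%Z = q - c - 1 by lia.
    exists (c + ((q - c) %/ 2)%Z); split; last by lia.
    by apply: (midconvex_int mP Pq Pc); lia.
  exists (c + 1 + ((q - c) %/ 2)%Z); split; last by lia.
  by apply: (midconvex_int mP Pq Pc1); lia.
have fill k : c <= k <= m -> P k by apply: IH => //; lia.
have [lenm|ltmn] := leP n m; first by apply: fill; lia.
apply: (IH (m - 1) q) => //; try lia; first by apply: fill; lia.
by rewrite subrK.
Qed.

Lemma midconvex_int_interval (P : set int) (c u v n : int) :
  midconvex P -> P c -> P (c + 1) -> P u -> P v -> u <= n <= v -> P n.
Proof.
move=> mP Pc Pc1 Pu Pv unv; have [lecn|ltnc] := leP c n.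
  by apply: (midconvex_int_fill_right mP Pc Pc1 Pv); lia.
(* Below c, the reflection of P contains the consecutive -(c + 1) and -c. *)
have mN : midconvex [set k : int | P (- k)].
  have := midconvex_affine (x := 0) (@opprD _) mP.
  by under eq_set do rewrite add0r.
rewrite -(opprK n).
apply: (midconvex_int_fill_right mN (c := - (c + 1)) (q := - u)); last by lia.
- by rewrite /= opprK.
- by rewrite /= opprD opprK addrK.
- by rewrite /= opprK.
Qed.

(** The case d = 0, where a = b, is that of P = {0}.  Writing d as a difference
    of two elements of P records that d is one of the differences, which is
    what identifies the multiples of d with a group generated by differences;
    the last clause holds because d is odd or 0. *)
Lemma midconvex_int_progression (P : set int) : midconvex P -> P 0 ->
  exists a b, [/\ P a, P b, forall p, P p -> (b - a %| p)%Z,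
    forall u v n, P u -> P v -> u <= n <= v -> (b - a %| n)%Z -> P n &
    forall n, (b - a %| n *+ 2)%Z -> (b - a %| n)%Z].
Proof.
move=> mP P0.
have [P1|] := pselect (forall p, P p -> p = 0).
  exists 0, 0; rewrite subr0; split=> // [p /P1->//|u v n _ _ _|n].
    by rewrite dvd0z => /eqP->.
  by rewrite !dvd0z mulrn_eq0.
move=> /existsNP[p /not_implyP[Pp p0]].
have gaps : exists n, `[< exists a, P a /\ P (a + n.+1%:Z) >].
  have [ltp0|lt0p|//] := ltgtP p 0; exists `|p|.-1; apply/asboolP.
    by exists p; split => //; rewrite (_ : p + _ = 0) //; lia.
  by exists 0; split => //; rewrite (_ : 0 + _ = p) //; lia.
case: (ex_minnP gaps) => d' /asboolP[a [Pa Pb]] mind'.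
set d : int := d'.+1%:Z in Pb.
have mind u v : P u -> P v -> u < v -> d <= v - u.
  move=> Pu Pv ltuv; have := mind' `|v - u|.-1.
  have -> : asbool (exists a, P a /\ P (a + (`|v - u|.-1.+1)%:Z)).
    by apply/asboolP; exists u; split=> //; rewrite (_ : u + _ = v) //; lia.
  by move=> /(_ isT); lia.
have [j dj] : exists j, d = j + j + 1.
  exists (d %/ 2)%Z; suff : d <> 2 * (d %/ 2)%Z by lia.
  move=> d2; have Pm : P (a + (d %/ 2)%Z).
    by apply: (midconvex_int mP Pa Pb); lia.
  by have := mind _ _ Pa Pm; lia.
(* No point of P is strictly between a and a + d, so going from q to a midpoint
   with one of them decreases the sum of the distances to both. *)
have dvdB q : P q -> (d %| q - a)%Z.
  have [N leN] : exists N : nat, `|q - a| + `|q - (a + d)| <= N%:Z.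
    by exists (absz (q - a)%R + absz (q - (a + d))%R)%N; lia.
  elim: N q leN => [|N IH] q leN Pq; first by lia.
  have [->|qa] := eqVneq q a; first by rewrite subrr dvdz0.
  have [->|qb] := eqVneq q (a + d); first by rewrite addrC addKr dvdzz.
  have outside : q < a \/ a + d < q.
    have [?|?|?] := ltgtP q a; [by left|right|by lia].
    by have := mind _ _ Pa Pq; lia.
  have step e m : P e -> (d %| e - a)%Z -> e = a \/ e = a + d ->
      m + m = q + e -> (d %| q - a)%Z.
    move=> Pe de ae m2; have Pm := midconvex_int mP Pq Pe m2.
    have mout := mind _ _ Pa Pm.
    have /IH /(_ Pm) dm : `|m - a| + `|m - (a + d)| <= N%:Z by lia.
    have -> : q - a = (m - a) + (m - a) - (e - a) by lia.
    exact: rpredB (rpredD dm dm) de.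
  have [q2|q2] : 2 * ((q - a) %/ 2)%Z = q - a \/
                 2 * ((q - a) %/ 2)%Z = q - a - 1 by lia.
    apply: (step a (a + ((q - a) %/ 2)%Z)) => //; last by lia.
      by rewrite subrr dvdz0.
    by left.
  apply: (step (a + d) (a + j + 1 + ((q - a) %/ 2)%Z)) => //; last by lia.
    by rewrite addrC addKr dvdzz.
  by right.
have da : (d %| a)%Z by rewrite -rpredN -sub0r; exact: dvdB.
exists a, (a + d); rewrite [_ - a]addrC addKr; split=> //.
- by move=> q /dvdB; rewrite rpredBr.
- move=> u v n Pu Pv unv dn.
  have mD : midconvex [set k : int | P (k * d)].
    have := midconvex_affine (x := 0) (fun u v => mulrDl u v d) mP.
    by under eq_set do rewrite add0r.
  have d0 : 0 < d by [].
  have [du dv] : (d %| u)%Z /\ (d %| v)%Z.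
    by split; rewrite -(rpredBr _ da) dvdB.
  rewrite -(divzK dn); apply: (midconvex_int_interval mD (c := (a %/ d)%Z)
    (u := (u %/ d)%Z) (v := (v %/ d)%Z)) => /=; rewrite ?mulrDl ?mul1r ?divzK //.
  case/andP: unv => un nv.
  by rewrite -(ler_pM2r d0) -[X in _ && X](ler_pM2r d0) !divzK ?un.
- move=> n /dvdzP[t nt]; apply/dvdzP.
  (* With d = 2j + 1 and 2n = t d, one has n = n d - j (2n) = (n - j t) d. *)
  exists (n - j * t).
  rewrite mulrBl -mulrA -nt dj; ring.
Qed.

(** * Quotients without elements of even order *)

Lemma pi_quot_eq0 (V : zmodType) (H : zmodClosed V) (y : V) :
  (\pi_(Quotient.quot H)%qT y == 0) = (y \in H).
Proof. by rewrite -[in RHS](subr0 y) Quotient.idealrBE raddf0. Qed.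

(** If g has order 2m, then m g is an element of order 2, so that elements of
    even order exist as soon as there is 2-torsion and only then. *)
Lemma no_even_order_quotP (V : zmodType) (H : zmodClosed V) :
  ~ (exists g : Quotient.quot H, has_even_order g) <->
  forall y, y *+ 2 \in H -> y \in H.
Proof.
split=> [noE y y2H|halfH [g [n [n_gt0 gn0 min_n] evn]]].
  apply/negPn/negP => yNH; apply: noE.
  exists (\pi_(Quotient.quot H)%qT y), 2 => //.
  split=> //; first by apply/eqP; rewrite -raddfMn pi_quot_eq0.
  by case=> [|[|m]] // _ /eqP; rewrite -raddfMn pi_quot_eq0 (negbTE yNH).
have nE : n = (n./2 + n./2)%N by rewrite addnn even_halfK.
suff /min_n : g *+ n./2 = 0 by lia.
elim/quotW: g gn0 {min_n} => y /eqP yn0; apply/eqP.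
rewrite -raddfMn pi_quot_eq0; apply: halfH.
by rewrite -pi_quot_eq0 -mulrnA muln2 even_halfK // raddfMn.
Qed.

Lemma zmod_closed_exists (V : zmodType) (S : {pred V}) :
  zmod_closed S -> exists H : zmodClosed V, forall h, (h \in H) = (h \in S).
Proof.
move=> clS.
pose S' : zmodClosed V :=
  HB.pack (S : pred V) (GRing.isZmodClosed.Build V S clS).
by exists S'.
Qed.

(** * Groups of rational numbers are locally cyclic *)

Lemma val_mulrz (G : zmodClosed rat) (y : subgroup G) (n : int) :
  val (y *~ n) = val y *~ n.
Proof. exact: (raddfMz (val : {additive subgroup G -> rat})). Qed.

(** Over the common denominator q, a = m / q and b = n / q, and the Bezout
    combination k of a and b equals gcd(m, n) / q. *)
Lemma common_divisor (G : zmodClosed rat) (a b : subgroup G) :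
  exists k, (exists i, a = k *~ i) /\ (exists j, b = k *~ j).
Proof.
pose q := denq (val a) * denq (val b).
pose m := numq (val a) * denq (val b); pose n := numq (val b) * denq (val a).
have [da0 db0] : (denq (val a))%:~R != 0 :> rat /\
                 (denq (val b))%:~R != 0 :> rat.
  by rewrite !intr_eq0 !denq_neq0.
have aq : val a * q%:~R = m%:~R.
  by rewrite -{1}[val a]divq_num_den !rmorphM /=; field.
have bq : val b * q%:~R = n%:~R.
  by rewrite -{1}[val b]divq_num_den !rmorphM /=; field; rewrite db0.
have q0 : q%:~R != 0 :> rat by rewrite rmorphM mulf_neq0.
clearbody m n q.
have [u [v uv]] := Bezoutz m n.
have /dvdzP[i mi] := dvdz_gcdl m n; have /dvdzP[j nj] := dvdz_gcdr m n.
pose k := a *~ u + b *~ v.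
have kq : val k * q%:~R = (gcdz m n)%:~R.
  rewrite GRing.valD !val_mulrz mulrDl !mulrzAl aq bq -uv.
  by rewrite [u * m]mulrC [v * n]mulrC mulrzDr !mulrzA.
exists k; split; [exists i|exists j]; apply: val_inj; apply: (mulIf q0);
  rewrite val_mulrz mulrzAl kq.
  by rewrite aq -mulrzA mulrC -mi.
by rewrite bq -mulrzA mulrC -nj.
Qed.

Lemma common_divisor_seq (G : zmodClosed rat) (s : seq (subgroup G)) :
  exists2 k, 0 <= val k & forall y, y \in s -> exists n, y = k *~ n.
Proof.
suff [k sk] : exists k, forall y, y \in s -> exists n, y = k *~ n.
  have [k_ge0|k_le0] := leP 0 (val k); first by exists k.
  exists (- k); first by rewrite GRing.valN oppr_ge0 ltW.
  by move=> y /sk[n ->]; exists (- n); rewrite mulrNz mulNrz opprK.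
elim: s => [|a s [k sk]]; first by exists 0.
have [l [ka kk]] := common_divisor a k.
exists l => y /[!inE] /predU1P[->//|/sk[n ->]].
by have [j ->] := kk; exists (j * n); rewrite mulrzA.
Qed.

(** * The group generated by the differences of a midconvex set *)

(** For a midconvex X, the multiples of single differences already form the
    group generated by all differences: finitely many differences are, in a
    common cyclic subgroup, multiples of one of them. *)
Definition multiple_of_difference (V : zmodType) (X : set V) : {pred V} :=
  fun h => `[< exists u v m, [/\ X u, X v & h = (v - u) *~ m] >].

(** A cyclic subgroup generated by k and containing any prescribed finite set s,
    together with the description of X in the coordinate n |-> x + k *~ n:
    X consists of the multiples of d in an interval, and the multiples of k *~ d
    are multiples of a difference of elements of X.  Taking k nonnegative makes
    the coordinate monotone. *)
Lemma midconvex_chart (G : zmodClosed rat) (X : set (subgroup G)) x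
    (s : seq (subgroup G)) :
  midconvex X -> X x ->
  exists k d, [/\ 0 <= val k,
    forall y, y \in s -> exists n, y = k *~ n,
    forall n, X (x + k *~ n) -> (d %| n)%Z,
    forall u v n, X (x + k *~ u) -> X (x + k *~ v) -> u <= n <= v ->
      (d %| n)%Z -> X (x + k *~ n) &
    (forall n, (d %| n *+ 2)%Z -> (d %| n)%Z) /\
    (forall n, (d %| n)%Z -> k *~ n \in multiple_of_difference X)].
Proof.
move=> mX Xx; have [k k_ge0 sk] := common_divisor_seq s; exists k.
have mP := midconvex_affine (x := x) (mulrzDr k) mX.
have P0 : X (x + k *~ 0) by rewrite mulr0z addr0.
have [a [b [Pa Pb dvd hull half]]] := midconvex_int_progression mP P0.
exists (b - a); split=> //; split=> // n /dvdzP[t ->]; apply/asboolP.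
exists (x + k *~ a), (x + k *~ b), t; split=> //.
by rewrite opprD addrACA subrr add0r -mulrzBr mulrzA mulrzAC.
Qed.

(** The converse to the last clause of [midconvex_chart]: in a chart reaching u
    and v, the multiples of v - u have their coordinates divisible by d. *)
Lemma multiple_of_difference_coord (V : zmodType) (X : set V) (x u v k : V)
    (d m : int) : (forall n, X (x + k *~ n) -> (d %| n)%Z) -> X u -> X v ->
  (exists n, u - x = k *~ n) -> (exists n, v - x = k *~ n) ->
  exists2 n, (v - u) *~ m = k *~ n & (d %| n)%Z.
Proof.
move=> dvd Xu Xv [i ui] [j vj]; exists ((j - i) * m).
  by rewrite mulrzA mulrzBr -ui -vj opprB addrA subrK.
by apply: dvdz_mulr; apply: rpredB; apply: dvd; rewrite -?ui -?vj subrKC.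
Qed.

(** Two multiples of differences have, in a common chart, coordinates divisible
    by the same d, and k *~ n is a multiple of a difference when d | n. *)
Lemma multiple_of_difference_closed (G : zmodClosed rat)
    (X : set (subgroup G)) :
  X !=set0 -> midconvex X -> zmod_closed (multiple_of_difference X).
Proof.
move=> [x Xx] mX; split=> [|_ h' /asboolP[u [v [m [Xu Xv ->]]]]].
  by apply/asboolP; exists x, x, 0; rewrite mulr0z.
move=> /asboolP[u' [v' [m' [Xu' Xv' ->]]]].
have [k [d [_ sk dvd _ [_ mem]]]] :=
  midconvex_chart [:: u - x; v - x; u' - x; v' - x] mX Xx.
have [||n -> dn] := multiple_of_difference_coord m dvd Xu Xv;
  try by apply: sk; rewrite !inE eqxx ?orbT.
have [||n' -> dn'] := multiple_of_difference_coord m' dvd Xu' Xv';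
  try by apply: sk; rewrite !inE eqxx ?orbT.
by rewrite -mulrzBr; apply: mem; apply: rpredB.
Qed.

Lemma multiple_of_difference_half (G : zmodClosed rat)
    (X : set (subgroup G)) y :
  X !=set0 -> midconvex X ->
  y *+ 2 \in multiple_of_difference X -> y \in multiple_of_difference X.
Proof.
move=> [x Xx] mX /asboolP[u [v [m [Xu Xv y2]]]].
have [k [d [_ sk dvd _ [half mem]]]] :=
  midconvex_chart [:: u - x; v - x; y] mX Xx.
have [||n uvn dn] := multiple_of_difference_coord m dvd Xu Xv;
  try by apply: sk; rewrite !inE eqxx ?orbT.
have [|i yi] := sk y; first by rewrite !inE eqxx ?orbT.
(* If k = 0, the coordinate does not determine the element, but y is 0. *)
have [k0|k0] := eqVneq (val k) 0.
  have -> : y = k *~ 0 by apply: val_inj; rewrite yi !val_mulrz k0 !mul0rz.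
  by apply: mem; rewrite dvdz0.
rewrite yi; apply: mem; apply: half; suff -> : i *+ 2 = n by [].
apply: (mulrIz k0); rewrite -!val_mulrz; congr val.
by rewrite -uvn -y2 yi -mulr_natr mulrzA.
Qed.

(** In a chart reaching a, b and the two points whose difference has h as a
    multiple, h + x has a coordinate divisible by d and between those of
    a and b. *)
Lemma midconvex_order_convex (G : zmodClosed rat)
    (X : set (subgroup G)) x h a b :
  midconvex X -> X x -> X a -> X b -> h \in multiple_of_difference X ->
  val a <= val (h + x) <= val b -> X (h + x).
Proof.
move=> mX Xx Xa Xb /asboolP[u [v [m [Xu Xv ->]]]].
have [k [d [k_ge0 sk dvd hull _]]] :=
  midconvex_chart [:: u - x; v - x; a - x; b - x] mX Xx.
have [||n -> dn] := multiple_of_difference_coord m dvd Xu Xv;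
  try by apply: sk; rewrite !inE eqxx ?orbT.
have [|i ai] := sk (a - x); first by rewrite !inE eqxx ?orbT.
have [|j bj] := sk (b - x); first by rewrite !inE eqxx ?orbT.
move: Xa Xb; rewrite -(subrK x a) -(subrK x b) ai bj ![_ + x]addrC => Xa Xb.
rewrite !GRing.valD !lerD2l !val_mulrz.
have [k0 _|k0] := eqVneq (val k) 0.
  suff -> : k = 0 by rewrite mul0rz addr0.
  exact: val_inj.
by rewrite !(ler_pMz2l) ?lt_def ?k0 // => inj; apply: (hull i j).
Qed.

(** * Midconvex sets of groups of rational numbers *)

(* [is_interval C] is order-convexity of C; [Quotient.quot H] is the group G / H. *)
Theorem theorem4 (G : zmodClosed rat) (X : set (subgroup G)) (X0 : X !=set0) :
  midconvex X <->
  exists (C : set rat) (x : subgroup G) (H : zmodClosed (subgroup G)),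
    [/\ is_interval C, X x,
        ~ (exists g : Quotient.quot H, has_even_order g) &
        val @` X = C `&` val @` translate [set` H] x].
Proof.
split=> [mX|[C [x [H [convC Xx /no_even_order_quotP halfH XE]]]]].
  have [x Xx] := X0.
  have [H HE] := zmod_closed_exists (multiple_of_difference_closed X0 mX).
  exists [set q | exists a b, [/\ X a, X b & val a <= q <= val b]], x, H.
  split=> //.
  - move=> p q [a [_ [Xa _ /andP[ap _]]]] [_ [b [_ Xb /andP[_ qb]]]] r.
    move=> /andP[pr rq].
    by exists a, b; split=> //; rewrite (le_trans ap) // (le_trans rq).
  - apply/no_even_order_quotP => y; rewrite !HE.
    exact: multiple_of_difference_half.
  - apply/seteqP; split.
      move=> _ [y Xy <-].
      split; first by exists y, y; rewrite lexx.
      exists y => //; exists (y - x); last by rewrite subrK.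
      by rewrite /= HE; apply/asboolP; exists x, y, 1; rewrite mulr1z.
    move=> q [[a [b [Xa Xb ayb]]] [z [h /= Hh <-] hx]].
    exists (h + x) => //; rewrite -hx in ayb.
    by apply: (midconvex_order_convex mX Xx Xa Xb) => //; rewrite -HE.
have memX y : X y <-> C (val y) /\ y - x \in H.
  split=> [Xy|[Cy Hy]].
    have : (C `&` val @` translate [set` H] x) (val y) by rewrite -XE; exists y.
    move=> [Cy [z [h /= Hh <-] /val_inj hy]].
    by split=> //; rewrite -hy addrK.
  have [z Xz /val_inj <-//] : (val @` X) (val y).
  rewrite XE; split=> //; exists y => //.
  by exists (y - x); rewrite ?subrK.
move=> y z /memX[Cy Hy] /memX[Cz Hz] w w2; apply/memX; split; last first.
  apply: halfH; rewrite mulrnBl w2 mulr2n opprD addrACA.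
  exact: rpredD.
have {w2}w2 : val w *+ 2 = val y + val z.
  by rewrite mulr2n -!GRing.valD -w2 mulr2n.
have [yz|zy] := leP (val y) (val z).
  by apply: (convC _ _ Cy Cz); lra.
by apply: (convC _ _ Cz Cy); lra.
Qed.
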